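(* Let $\mathcal X \in \mathbb R^{D_1 \times \cdots \times D_N}$ and let $d_n \le D_n$ for $n \in [N]$. Let $\{\mathbf U_n^{(q)}\}_{n\in[N],\, q\ge 0}$ be the bases and $\mathbf A_n^{(q)}$ the matrices generated by the L1-HOOI iterations (described in the context) applied to $\mathcal X$, from an arbitrary feasible initialization $\{\mathbf U_n^{(0)} \in \mathbb S(D_n,d_n)\}_{n\in[N]}$. Then for any $n \in [N]$ and all iteration indices $q' > q \ge 1$, $$\left\|{\mathbf U_{n}^{(q')}}^\top\mathbf A_{n}^{(q')}\right\|_1 \geq \left\|{\mathbf U_n^{(q)}}^\top\mathbf A_n^{(q)}\right\|_1 .$$
   Context: Notation: $[N]=\{1,\dots,N\}$; $\mathbb S(D,d)=\{\mathbf U\in\mathbb R^{D\times d}: \mathbf U^\top\mathbf U=\mathbf I_d\}$; $\|\cdot\|_1$ is the entrywise L1-norm (sum of absolute values of all entries) of a matrix or tensor. For a tensor $\mathcal X\in\mathbb R^{D_1\times\cdots\times D_N}$, $[\mathcal X]_{(n)}\in\mathbb R^{D_n\times\prod_{m\ne n}D_m}$ is the mode-$n$ unfolding (its columns are the mode-$n$ fibers, in the standard order), and $\times_n$ is the mode-$n$ tensor-by-matrix product, so that $[\mathcal X\times_n\mathbf M]_{(n)}=\mathbf M[\mathcal X]_{(n)}$; $\times_{m<n}$, $\times_{k>n}$ denote successive products over all modes $m<n$, respectively $k>n$. L1PCA-AO: for $\mathbf A\in\mathbb R^{D\times d}$ with $d\le D$ and (thin) SVD $\mathbf A=\mathbf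 W\mathbf S\mathbf Q^\top$ ($\mathbf W\in\mathbb S(D,d)$, $\mathbf S\in\mathbb R^{d\times d}$ nonnegative diagonal, $\mathbf Q\in\mathbb R^{d\times d}$ orthogonal), put $\Phi(\mathbf A)=\mathbf W\mathbf Q^\top$ (any SVD may be chosen). $\mathrm{sgn}(\cdot)$ acts entrywise with values in $\{\pm1\}$ and $\mathrm{sgn}(0)=1$. Given a matrix $\mathbf X\in \mathbb R^{D\times D'}$ and $\mathbf U_0\in\mathbb S(D,d)$, $\texttt{L1PCA-AO}(\mathbf X,\mathbf U_0)$ is the matrix obtained after some finite number $T\ge1$ (decided by any termination rule) of the iterations $\mathbf U_t=\Phi(\mathbf X\,\mathrm{sgn}(\mathbf X^\top\mathbf U_{t-1}))$, $t=1,\dots,T$. L1-HOOI: starting from arbitrary $\mathbf U_n^{(0)}\in\mathbb S(D_n,d_n)$, $n\in[N]$, for $q=1,2,\dots$ and, within each $q$, successively for $n=1,2,\dots,N$, set $\mathbf U_n^{(q)}=\texttt{L1PCA-AO}(\mathbf A_n^{(q)},\mathbf U_n^{(q-1)})$, where $$\mathbf A_n^{(q)}=\Big[\mathcal X\times_{m<n}{\mathbf U_m^{(q)}}^\top\times_{k>n}{\mathbf U_k^{(q-1)}}^\top\Big]_{(n)}.$$ *)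

(* Defs.v *)
From HB Require Import structures.
From mathcomp Require Import all_boot all_order all_algebra.
From mathcomp Require Import reals.

Set Implicit Arguments.
Unset Strict Implicit.
Unset Printing Implicit Defensive.

Import Order.TTheory GRing.Theory Num.Theory.
Local Open Scope ring_scope.

Definition stiefel (R : realType) (D d : nat) (U : 'M[R]_(D, d)) : Prop :=
  U^T *m U = 1%:M.

Definition l1norm (R : realType) (m n : nat) (A : 'M[R]_(m, n)) : R :=
  \sum_i \sum_j `|A i j|.

(** Unlike [Num.sg], this sign takes the value 1 at 0. *)
Definition sgn1 (R : realType) (x : R) : R := if 0 <= x then 1 else -1.

Definition thin_svd (R : realType) (D d : nat) (A W : 'M[R]_(D, d))
    (s : 'rV[R]_d) (Q : 'M[R]_d) : Prop :=
  [/\ stiefel W, forall i, 0 <= s 0 i, stiefel Q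
    & A = W *m diag_mx s *m Q^T].

(** [Phi] is a relation because an SVD, and hence [W *m Q^T], need not be
    unique: every choice of SVD is allowed. *)
Definition Phi (R : realType) (D d : nat) (A P : 'M[R]_(D, d)) : Prop :=
  exists W s Q, thin_svd A W s Q /\ P = W *m Q^T.

(** [U] is a possible output on input [(X, U0)]; the number [T] of iterations is
    left free, so that every termination rule is covered. *)
Definition l1pca_ao (R : realType) (D D' d : nat) (X : 'M[R]_(D, D'))
    (U0 U : 'M[R]_(D, d)) : Prop :=
  exists (T : nat) (V : nat -> 'M[R]_(D, d)),
    [/\ (0 < T)%N, V 0%N = U0,
        forall t, (t < T)%N ->
          Phi (X *m map_mx (@sgn1 R) (X^T *m V t)) (V t.+1)
      & V T = U].

Definition tindex (N : nat) (D : 'I_N -> nat) : finType :=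
  {dffun forall m : 'I_N, 'I_(D m)}.

Definition tensor (R : realType) (N : nat) (D : 'I_N -> nat) : Type :=
  {ffun tindex D -> R}.

(** Column of the mode-[n] unfolding that holds the entry of index [i]: the
    indices other than the [n]-th are read with the lowest mode varying
    fastest. *)
Definition unfold_col (N : nat) (D : 'I_N -> nat) (n : 'I_N) (i : tindex D)
    : nat :=
  (\sum_(k < N | k != n) i k * \prod_(m < N | (m < k) && (m != n)) D m)%N.

(** The sum has exactly one term. *)
Definition unfold (R : realType) (N : nat) (D : 'I_N -> nat) (n : 'I_N)
    (X : tensor R D) : 'M[R]_(D n, (\prod_(m < N | m != n) D m)%N) :=
  \matrix_(a, b) \sum_(i : tindex D | (i n == a) && (unfold_col n i == b)) X i.

Definition upd (N : nat) (D : 'I_N -> nat) (n : 'I_N) (J : nat) : 'I_N -> nat :=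
  fun m => if m == n then J else D m.

Lemma upd_same (N : nat) (D : 'I_N -> nat) (n : 'I_N) (J : nat) :
  upd D n J n = J.
Proof. by rewrite /upd eqxx. Qed.

(** Mode-[n] product.  The sum ranges over the indices [k] that agree with [i]
    in all modes but [n], i.e. over the [n]-th coordinate of [k]; agreement is
    tested in [nat] since ['I_(upd D n J m)] and ['I_(D m)] are only provably
    equal. *)
Definition ttm (R : realType) (N : nat) (D : 'I_N -> nat) (n : 'I_N) (J : nat)
    (X : tensor R D) (M : 'M[R]_(J, D n)) : tensor R (upd D n J) :=
  [ffun i : tindex (upd D n J) =>
    \sum_(k : tindex D | [forall m, (m != n) ==> (k m == i m :> nat)])
      M (cast_ord (upd_same D n J) (i n)) (k n) * X k].

Fixpoint upds (N : nat) (D d : 'I_N -> nat) (s : seq 'I_N) : 'I_N -> nat :=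
  if s is m :: s' then upd (upds D d s') m (d m) else D.

Lemma upds_notin (N : nat) (D d : 'I_N -> nat) (s : seq 'I_N) (n : 'I_N) :
  n \notin s -> upds D d s n = D n.
Proof.
elim: s => //= m s IHs; rewrite inE negb_or => /andP[/negbTE nm ns].
by rewrite /upd nm IHs.
Qed.

Lemma cons_uniq_notin (T : eqType) (x : T) (s : seq T) :
  uniq (x :: s) -> x \notin s.
Proof. by case/andP. Qed.

Lemma cons_uniq_tail (T : eqType) (x : T) (s : seq T) :
  uniq (x :: s) -> uniq s.
Proof. by case/andP. Qed.

(** Successive mode products by [V m] for [m] in [s].  The last mode of [s] is
    applied first. *)
Fixpoint ttms (R : realType) (N : nat) (D d : 'I_N -> nat) (X : tensor R D)
    (V : forall m, 'M[R]_(d m, D m)) (s : seq 'I_N)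
    : uniq s -> tensor R (upds D d s) :=
  match s return uniq s -> tensor R (upds D d s) with
  | [::] => fun _ => X
  | m :: s' => fun us =>
      ttm (ttms X V (cons_uniq_tail us))
        (castmx (erefl (d m), esym (upds_notin D d (cons_uniq_notin us))) (V m))
  end.

(** The modes other than [n], in decreasing order, so that [ttms] applies them
    in increasing order. *)
Definition other_modes (N : nat) (n : 'I_N) : seq 'I_N :=
  rev [seq m <- enum 'I_N | m != n].

Lemma other_modes_uniq (N : nat) (n : 'I_N) : uniq (other_modes n).
Proof. by rewrite rev_uniq filter_uniq // enum_uniq. Qed.

Lemma other_modes_notin (N : nat) (n : 'I_N) : n \notin other_modes n.
Proof. by rewrite mem_rev mem_filter eqxx. Qed.

(** The matrix [A_n^(q)] for [q >= 1]. *)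
Definition hooi_mx (R : realType) (N : nat) (D d : 'I_N -> nat)
    (X : tensor R D) (U : nat -> forall m, 'M[R]_(D m, d m)) (q : nat)
    (n : 'I_N)
    : 'M[R]_(D n, (\prod_(m < N | m != n) upds D d (other_modes n) m)%N) :=
  castmx (upds_notin D d (other_modes_notin n), erefl)
    (unfold n
      (ttms X (fun m => (if (m < n)%N then U q m else U q.-1 m)^T)
        (other_modes_uniq n))).

(** [U q m] is the basis [U_m^(q)] of a run from the initialization [U 0]. *)
Definition l1_hooi (R : realType) (N : nat) (D d : 'I_N -> nat)
    (X : tensor R D) (U : nat -> forall m, 'M[R]_(D m, d m)) : Prop :=
  (forall n, stiefel (U 0%N n)) /\
  (forall q n, (1 <= q)%N -> l1pca_ao (hooi_mx X U q n) (U q.-1 n) (U q n)).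

(* Main.v *)
Require Import Defs.
From HB Require Import structures.
From mathcomp Require Import all_boot all_order all_algebra.
From mathcomp Require Import reals.

Set Implicit Arguments.
Unset Strict Implicit.
Unset Printing Implicit Defensive.

Import Order.TTheory GRing.Theory Num.Theory.
Local Open Scope ring_scope.

(** Every [||U_n^T A_n||_1] is the L1-norm of the core tensor obtained by
    compressing [X] along all modes with the bases current at that moment, so it
    does not depend on the mode along which the core is unfolded.  Updating one
    basis by L1PCA-AO cannot decrease this common objective: by the Procrustes
    property of [Phi], with [S = sgn (X^T V)] and [P = Phi (X S)],
    [||V^T X||_1 = tr (V^T X S) <= tr (P^T X S) <= ||P^T X||_1].  Chaining these
    inequalities over the updates of successive sweeps gives the claim. *)

(** * Sign matrices and the L1-norm *)

Lemma mul_sgn1_le (R : realType) (x y : R) : x * sgn1 y <= `|x|.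
Proof.
rewrite /sgn1; case: ifP => _; first by rewrite mulr1 ler_norm.
by rewrite mulrN1 -normrN ler_norm.
Qed.

Lemma mul_sgn1 (R : realType) (x : R) : x * sgn1 x = `|x|.
Proof.
rewrite /sgn1; case: ifP => [x_ge0|/negbT]; first by rewrite mulr1 ger0_norm.
by rewrite -ltNge mulrN1 => /ltr0_norm ->.
Qed.

Lemma mxtrace_sgn1_le (R : realType) (m n : nat) (B C : 'M[R]_(m, n)) :
  \tr (B *m map_mx (@sgn1 R) C^T) <= l1norm B.
Proof.
rewrite /mxtrace /l1norm; apply: ler_sum => i _; rewrite mxE.
by apply: ler_sum => j _; rewrite !mxE mul_sgn1_le.
Qed.

Lemma mxtrace_sgn1 (R : realType) (m n : nat) (B : 'M[R]_(m, n)) :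
  \tr (B *m map_mx (@sgn1 R) B^T) = l1norm B.
Proof.
rewrite /mxtrace /l1norm; apply: eq_bigr => i _; rewrite mxE.
by apply: eq_bigr => j _; rewrite !mxE mul_sgn1.
Qed.

(** * The Procrustes property and monotonicity of L1PCA-AO *)

Lemma stiefel_mul_orthogonal (R : realType) (D d : nat) (W : 'M[R]_(D, d))
    (Q : 'M[R]_d) : stiefel W -> Q^T *m Q = 1%:M -> stiefel (W *m Q).
Proof.
move=> hW hQ.
by rewrite /stiefel trmx_mul mulmxA -(mulmxA Q^T) hW mulmx1.
Qed.

(** The entry is an inner product of two unit columns; it is bounded by summing [2ab <= a^2 + b^2]
    over the coordinates. *)
Lemma stiefel_diag_le1 (R : realType) (D d : nat) (V W : 'M[R]_(D, d))
    (i : 'I_d) : stiefel V -> stiefel W -> (V^T *m W) i i <= 1.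
Proof.
move=> /(congr1 (fun M : 'M_d => M i i)) hV /(congr1 (fun M : 'M_d => M i i)) hW.
(* Doubling both sides lets the bound 2 be read as the sum of the two squared column norms. *)
rewrite -(ler_pMn2r (ltn0Sn 1)).
have -> : 1 *+ 2 = (V^T *m V) i i + (W^T *m W) i i :> R.
  by rewrite hV hW !mxE eqxx.
rewrite !mxE -big_split -sumrMnl; apply: ler_sum => k _ /=.
rewrite !mxE -subr_ge0.
suff -> : V k i * V k i + W k i * W k i - V k i * W k i *+ 2
          = (V k i - W k i) ^+ 2 by apply: sqr_ge0.
by rewrite sqrrB !expr2 addrAC.
Qed.

Lemma Phi_stiefel (R : realType) (D d : nat) (A P : 'M[R]_(D, d)) :
  Phi A P -> stiefel P.
Proof.
move=> [W [s [Q [[hW _ hQ _] ->]]]].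
(* [Q] is square, so [Q^T *m Q = 1] also gives [Q *m Q^T = 1]. *)
by apply: stiefel_mul_orthogonal; rewrite // trmxK; apply: mulmx1C.
Qed.

(* Orthogonal Procrustes: with [A = W S Q^T], the trace of [V^T A] is
   [\sum_i s_i ((V Q)^T W)_ii], while [P = W Q^T] attains [\sum_i s_i]. *)
Lemma Phi_maximizes_trace (R : realType) (D d : nat) (A P V : 'M[R]_(D, d)) :
  Phi A P -> stiefel V -> \tr (V^T *m A) <= \tr (P^T *m A).
Proof.
move=> [W [s [Q [[hW s_ge0 hQ ->] ->]]]] hV.
have trE (Z : 'M[R]_(D, d)) :
    \tr (Z^T *m (W *m diag_mx s *m Q^T))
    = \sum_i ((Z *m Q)^T *m W) i i * s 0 i.
  rewrite !mulmxA mxtrace_mulC !mulmxA -trmx_mul.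
  by apply: eq_bigr => i _; rewrite mul_mx_diag mxE.
rewrite !trE -mulmxA hQ mulmx1 hW; apply: ler_sum => i _.
apply: ler_wpM2r; first exact: s_ge0.
by rewrite [leRHS]mxE eqxx stiefel_diag_le1 //; apply: stiefel_mul_orthogonal.
Qed.

Lemma Phi_sgn_l1norm_le (R : realType) (D D' d : nat) (X : 'M[R]_(D, D'))
    (V P : 'M[R]_(D, d)) :
  stiefel V -> Phi (X *m map_mx (@sgn1 R) (X^T *m V)) P ->
  l1norm (V^T *m X) <= l1norm (P^T *m X).
Proof.
move=> hV hP; rewrite -mxtrace_sgn1.
apply: le_trans (mxtrace_sgn1_le (P^T *m X) (V^T *m X)).
by rewrite trmx_mul trmxK -!mulmxA; apply: Phi_maximizes_trace.
Qed.

(** As [T] is positive, the output is itself a value of [Phi]. *)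
Lemma l1pca_ao_stiefel (R : realType) (D D' d : nat) (X : 'M[R]_(D, D'))
    (U0 U : 'M[R]_(D, d)) : l1pca_ao X U0 U -> stiefel U.
Proof.
by move=> [[|T] [V [// _ _ hV <-]]]; apply: Phi_stiefel (hV T (ltnSn T)).
Qed.

Lemma l1pca_ao_l1norm_le (R : realType) (D D' d : nat) (X : 'M[R]_(D, D'))
    (U0 U : 'M[R]_(D, d)) :
  stiefel U0 -> l1pca_ao X U0 U -> l1norm (U0^T *m X) <= l1norm (U^T *m X).
Proof.
move=> hU0 [T [V [_ V0 hV <-]]].
suff /(_ T (leqnn T))[] : forall t, (t <= T)%N ->
    stiefel (V t) /\ l1norm (U0^T *m X) <= l1norm ((V t)^T *m X) by [].
elim=> [_|t IHt lt_tT]; first by rewrite V0.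
have [st le_t] := IHt (ltnW lt_tT); have hPhi := hV t lt_tT.
split; first exact: Phi_stiefel hPhi.
exact: le_trans le_t (Phi_sgn_l1norm_le st hPhi).
Qed.

(** * Mixed-radix numerals and the columns of an unfolding *)

(** By induction the lower digits amount to less than the top place value [P], so the numeral is
    below [(f n).+1 * P <= E n * P]. *)
Lemma mixed_radix_lt (E f : nat -> nat) (n : nat) :
  (forall k, k < n -> f k < E k)%N ->
  (\sum_(k < n) f k * \prod_(m < k) E m < \prod_(m < n) E m)%N.
Proof.
elim: n => [|n IHn] hf; first by rewrite !big_ord0.
rewrite !big_ord_recr /=.
have /IHn lt_n : forall k, (k < n -> f k < E k)%N.
  by move=> k lt_kn; apply/hf/ltnW.
apply: leq_trans (_ : (f n).+1 * \prod_(m < n) E m <= _)%N.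
  by rewrite mulSn ltn_add2r.
by rewrite mulnC leq_mul2l hf ?orbT.
Qed.

(** Division by the top place value isolates the top digit as quotient and the lower digits as
    remainder; induction applies to the remainder. *)
Lemma mixed_radix_inj (E f g : nat -> nat) (n : nat) :
  (forall k, k < n -> f k < E k)%N -> (forall k, k < n -> g k < E k)%N ->
  (\sum_(k < n) f k * \prod_(m < k) E m
    = \sum_(k < n) g k * \prod_(m < k) E m)%N ->
  forall k, (k < n)%N -> f k = g k.
Proof.
elim: n => [//|n IHn] hf hg.
have hf' k : (k < n -> f k < E k)%N by move=> lt_kn; apply/hf/ltnW.
have hg' k : (k < n -> g k < E k)%N by move=> lt_kn; apply/hg/ltnW.
have ltf := mixed_radix_lt hf'; have ltg := mixed_radix_lt hg'.
rewrite !big_ord_recr /= => eq_fg.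
have P_gt0 : (0 < \prod_(m < n) E m)%N by apply: leq_ltn_trans ltf.
have eq_mod := congr1 (modn^~ (\prod_(m < n) E m)%N) eq_fg.
have eq_div := congr1 (divn^~ (\prod_(m < n) E m)%N) eq_fg.
rewrite /= ![(_ + _ * _)%N]addnC !modnMDl !modn_small // in eq_mod.
rewrite /= ![(_ + _ * _)%N]addnC !divnMDl // !divn_small // !addn0 in eq_div.
move=> k; rewrite ltnS leq_eqVlt => /orP[/eqP-> //|].
exact: IHn.
Qed.

(* Giving mode [n] dimension 1 and digit 0 turns [unfold_col n] into a plain
   mixed-radix numeral over all modes. *)
Definition ndim (N : nat) (n : 'I_N) (E : 'I_N -> nat) (k : nat) : nat :=
  if insub k is Some m then if m == n then 1%N else E m else 1%N.

Definition ndig (N : nat) (n : 'I_N) (f : 'I_N -> nat) (k : nat) : nat :=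
  if insub k is Some m then if m == n then 0%N else f m else 0%N.

Lemma ndimE (N : nat) (n : 'I_N) (E : 'I_N -> nat) (m : 'I_N) :
  ndim n E m = if m == n then 1%N else E m.
Proof. by rewrite /ndim valK. Qed.

Lemma ndigE (N : nat) (n : 'I_N) (f : 'I_N -> nat) (m : 'I_N) :
  ndig n f m = if m == n then 0%N else f m.
Proof. by rewrite /ndig valK. Qed.

Lemma prod_ndim (N : nat) (n : 'I_N) (E : 'I_N -> nat) (k : 'I_N.+1) :
  (\prod_(m < k) ndim n E m = \prod_(m < N | (m < k) && (m != n)) E m)%N.
Proof.
rewrite (big_ord_widen N (ndim n E)) ?leq_ord // big_mkcondr /=.
by apply: eq_bigr => m _; rewrite ndimE; case: eqP.
Qed.

Lemma unfold_colE (N : nat) (E : 'I_N -> nat) (n : 'I_N) (i : tindex E) :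
  unfold_col n i
  = (\sum_(k < N) ndig n (fun m => i m) k * \prod_(m < k) ndim n E m)%N.
Proof.
rewrite /unfold_col big_mkcond /=; apply: eq_bigr => k _.
by rewrite ndigE -(prod_ndim n E (widen_ord (leqnSn N) k)); case: eqP.
Qed.

Lemma ndig_lt (N : nat) (E : 'I_N -> nat) (n : 'I_N) (i : tindex E) (k : nat) :
  (k < N)%N -> (ndig n (fun m => i m) k < ndim n E k)%N.
Proof.
by move=> lt_kN; rewrite -[k]/(nat_of_ord (Ordinal lt_kN)) ndigE ndimE; case: eqP.
Qed.

Lemma unfold_col_lt (N : nat) (E : 'I_N -> nat) (n : 'I_N) (i : tindex E) :
  (unfold_col n i < \prod_(m < N | m != n) E m)%N.
Proof.
rewrite unfold_colE; have := mixed_radix_lt (ndig_lt n i).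
rewrite (prod_ndim n E ord_max).
by under [X in (_ < X)%N -> _]eq_bigl => m do rewrite /= ltn_ord.
Qed.

Lemma unfold_col_inj (N : nat) (E : 'I_N -> nat) (n : 'I_N) (i j : tindex E) :
  unfold_col n i = unfold_col n j -> forall m, m != n -> i m = j m.
Proof.
rewrite !unfold_colE => eq_col m /negbTE mn.
have := mixed_radix_inj (ndig_lt n i) (ndig_lt n j) eq_col (ltn_ord m).
by rewrite !ndigE mn => /val_inj.
Qed.

(** Two dimension families are allowed because a core index has to be compared with an index of a
    tensor left uncompressed in mode [n]. *)
Lemma eq_unfold_col (N : nat) (E E' : 'I_N -> nat) (n : 'I_N) (i : tindex E)
    (j : tindex E') :
  (forall m, m != n -> E m = E' m) -> (forall m, m != n -> i m = j m :> nat) ->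
  unfold_col n i = unfold_col n j.
Proof.
move=> eqE eqij; apply: eq_bigr => k kn; rewrite eqij //.
by congr (_ * _)%N; apply: eq_bigr => m /andP[_ /eqE].
Qed.

(** * Entries of successive mode products *)

(** Going through naturals allows coordinates to be pasted together from indices of different
    dimension families. *)
Definition mk_tindex (N : nat) (E : 'I_N -> nat) (f : 'I_N -> nat)
    (hf : forall m, (f m < E m)%N) : tindex E :=
  [ffun m => Ordinal (hf m)].

Lemma mk_tindexE (N : nat) (E : 'I_N -> nat) (f : 'I_N -> nat)
    (hf : forall m, (f m < E m)%N) (m : 'I_N) : mk_tindex hf m = f m :> nat.
Proof. by rewrite ffunE. Qed.

Lemma tindex_eqP (N : nat) (E : 'I_N -> nat) (i j : tindex E) :
  (forall m, i m = j m :> nat) -> i = j.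
Proof. by move=> eqij; apply/ffunP => m; apply/val_inj/eqij. Qed.

(* Entries addressed by naturals do not change under [castmx]. *)
Definition nent (R : realType) (m n : nat) (A : 'M[R]_(m, n)) (i j : nat) : R :=
  if insub i is Some a then if insub j is Some b then A a b else 0 else 0.

Lemma nentE (R : realType) (m n : nat) (A : 'M[R]_(m, n)) (i : 'I_m) (j : 'I_n) :
  nent A i j = A i j.
Proof. by rewrite /nent !valK. Qed.

Lemma nent_cast (R : realType) (m n m' n' : nat) (e : (m = m') * (n = n'))
    (A : 'M[R]_(m, n)) (i j : nat) : nent (castmx e A) i j = nent A i j.
Proof. by case: e => e1 e2; case: m' / e1; case: n' / e2. Qed.

Lemma upds_in (N : nat) (D d : 'I_N -> nat) (s : seq 'I_N) (m : 'I_N) :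
  m \in s -> upds D d s m = d m.
Proof.
elim: s => //= k s IHs; rewrite inE /upd.
by case: (m =P k) => [->|_ /IHs].
Qed.

(** Induction on [s]: the outer product yields a double sum over an intermediate index [k'] and an
    index [k] of [X]. After exchanging the sums, [k'] is forced and the inner sum has one term. *)
Lemma ttmsE (R : realType) (N : nat) (D d : 'I_N -> nat) (X : tensor R D)
    (V : forall m, 'M[R]_(d m, D m)) (s : seq 'I_N) (us : uniq s)
    (i : tindex (upds D d s)) :
  ttms X V us i
  = \sum_(k : tindex D | [forall m, (m \notin s) ==> (k m == i m :> nat)])
      (\prod_(m <- s) nent (V m) (i m) (k m)) * X k.
Proof.
elim: s us i => [|m0 s IHs] us i.
  rewrite [LHS]/= (big_pred1 i) => [|k /=]; first by rewrite big_nil mul1r.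
  apply/forallP/eqP => [eq_ki|-> //].
  by apply: tindex_eqP => m; apply/eqP; have := eq_ki m.
have m0s := cons_uniq_notin us.
rewrite [LHS]ffunE.
under eq_bigr => k' _ do rewrite IHs mulr_sumr.
rewrite (exchange_big_dep [pred k : tindex D |
    [forall m, (m \notin m0 :: s) ==> (k m == i m :> nat)]]) /=; last first.
  move=> k' k /forallP eq_k'i /forallP eq_kk'; apply/forallP => m.
  apply/implyP; rewrite inE negb_or => /andP[mm0 ms].
  rewrite (eqP (implyP (eq_kk' m) ms)).
  by have := eq_k'i m; rewrite mm0.
apply: eq_bigr => k /forallP eq_ki.
(* The forced intermediate index: it follows [k] in the mode being contracted and [i] in all
   others. *)
have hf m : ((if m == m0 then k m0 : nat else i m) < upds D d s m)%N.
  case: eqP => [->|/eqP/negbTE mm0]; first by rewrite upds_notin.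
  by have := ltn_ord (i m); rewrite [upds _ _ (_ :: _) _]/= {2}/upd mm0.
rewrite (big_pred1 (mk_tindex hf)) => [|k' /=].
  rewrite mulrA big_cons -nentE nent_cast /= mk_tindexE eqxx.
  congr (_ * _ * _); apply: eq_big_seq => m ms.
  by rewrite mk_tindexE; case: eqP => // mm0; rewrite -mm0 ms in m0s.
apply/andP/eqP => [[/forallP eq_k'i /forallP eq_kk']|->].
  apply: tindex_eqP => m; rewrite mk_tindexE; case: eqP => [->|/eqP mm0].
    by have := eq_kk' m0; rewrite m0s => /eqP.
  by have := eq_k'i m; rewrite mm0 => /eqP.
split; apply/forallP => m; apply/implyP => hm; rewrite mk_tindexE.
  by rewrite (negbTE hm).
have [-> //|mm0] := eqVneq m m0.
by apply: (implyP (eq_ki m)); rewrite inE negb_or mm0.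
Qed.

(** * The common objective, read off any unfolding *)

(** A closed formula that singles out no mode and no order of the products, so that all unfoldings
    can be compared with it. *)
Definition core_l1 (R : realType) (N : nat) (D d : 'I_N -> nat)
    (X : tensor R D) (V : forall m, 'M[R]_(D m, d m)) : R :=
  \sum_(j : tindex d) `|\sum_(k : tindex D) (\prod_m V m (k m) (j m)) * X k|.

Lemma mul_unfoldE (R : realType) (N : nat) (E : 'I_N -> nat) (n : 'I_N)
    (J : nat) (M : 'M[R]_(J, E n)) (T : tensor R E) (a : 'I_J)
    (b : 'I_(\prod_(m < N | m != n) E m)%N) :
  (M *m unfold n T) a b
  = \sum_(i : tindex E | unfold_col n i == b) M a (i n) * T i.
Proof.
rewrite mxE (partition_big (fun i : tindex E => i n) xpredT) //=.
apply: eq_bigr => c _; rewrite mxE mulr_sumr.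
apply: eq_big => [i|i /andP[/eqP-> _] //]; exact: andbC.
Qed.

Lemma mul_castmx (R : realType) (m n n' p : nat) (e : n' = n)
    (A : 'M[R]_(m, n)) (B : 'M[R]_(n', p)) :
  A *m castmx (e, erefl) B = castmx (erefl, esym e) A *m B.
Proof. by case: n / e A. Qed.

Lemma mem_other_modes (N : nat) (n m : 'I_N) : (m \in other_modes n) = (m != n).
Proof. by rewrite mem_rev mem_filter mem_enum andbT. Qed.

Lemma big_other_modes (R : realType) (N : nat) (n : 'I_N) (f : 'I_N -> R) :
  \prod_(m <- other_modes n) f m = \prod_(m | m != n) f m.
Proof.
rewrite (perm_big [seq m <- enum 'I_N | m != n]) ?perm_rev //=.
by rewrite big_filter big_enum_cond.
Qed.

(** Multiplying by [(V n)^T] contracts the one remaining mode, so the matrix holds the core entries,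
    each exactly once. *)
Lemma l1norm_unfold_ttms (R : realType) (N : nat) (D d : 'I_N -> nat)
    (X : tensor R D) (V : forall m, 'M[R]_(D m, d m)) (n : 'I_N)
    (W : forall m, 'M[R]_(d m, D m)) :
  (forall m, m != n -> W m = (V m)^T) ->
  l1norm ((V n)^T *m
    castmx (upds_notin D d (other_modes_notin n), erefl)
      (unfold n (ttms X W (other_modes_uniq n))))
  = core_l1 X V.
Proof.
move=> eqW; rewrite mul_castmx /l1norm /core_l1 pair_big /=.
set E := upds D d (other_modes n).
have eqE m : m != n -> d m = E m.
  by move=> mn; rewrite /E upds_in ?mem_other_modes.
have lt_col (j : tindex d) : (unfold_col n j < \prod_(m < N | m != n) E m)%N.
  rewrite (leq_trans (unfold_col_lt n j)) // leq_eqVlt; apply/orP; left.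
  by apply/eqP; apply: eq_bigr.
(* The row and column where the core entry of index [j] sits. *)
pose h (j : tindex d) := (j n, Ordinal (lt_col j)).
have h_inj : injective h.
  move=> j j' [eq_n /unfold_col_inj eq_j]; apply: tindex_eqP => m.
  by have [->|/eq_j->] := eqVneq m n; first by rewrite eq_n.
have h_bij : bijective h.
  (* Both sides have [\prod_m d m] elements, so injectivity is enough. *)
  apply: inj_card_bij h_inj _.
  rewrite card_prod !card_ord card_dep_ffun foldrE big_map big_enum /=.
  rewrite [leqRHS](bigD1 n) //= card_ord leq_mul2l; apply/orP; right.
  by apply: eq_leq; apply: eq_bigr => m /eqE <-; rewrite card_ord.
rewrite (reindex h) /=; last exact: onW_bij.
apply: eq_bigr => j _; congr `|_|; rewrite mul_unfoldE.
under [LHS]eq_bigr => i _ do rewrite ttmsE mulr_sumr.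
rewrite (exchange_big_dep xpredT) //=; apply: eq_bigr => k _.
(* The only index of the partly compressed tensor that lies in the column of [j] and agrees with [k]
   in mode [n]. *)
have hf m : ((if m == n then k n : nat else j m) < E m)%N.
  case: eqP => [->|/eqP/eqE <- //]; by rewrite /E upds_notin ?other_modes_notin.
have eq_col : unfold_col n (mk_tindex hf) = unfold_col n j.
  apply: eq_unfold_col => m mn; first by rewrite eqE.
  by rewrite mk_tindexE (negbTE mn).
rewrite (big_pred1 (mk_tindex hf)) => [|i /=].
  rewrite mulrA -nentE nent_cast mk_tindexE eqxx nentE mxE.
  rewrite (bigD1 n) //=; congr (_ * _ * _).
  rewrite big_other_modes; apply: eq_bigr => m mn.
  by rewrite eqW // mk_tindexE (negbTE mn) nentE mxE.
rewrite -eq_col; apply/andP/eqP => [[/eqP eq_i /forallP eq_ki]|->].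
  apply: tindex_eqP => m; have [->|/(unfold_col_inj eq_i)-> //] := eqVneq m n.
  have := eq_ki n; rewrite other_modes_notin mk_tindexE eqxx => /eqP eq_kn.
  by rewrite eq_kn.
split=> //; apply/forallP => m; rewrite mem_other_modes negbK mk_tindexE.
by apply/implyP => /eqP->; rewrite eqxx.
Qed.

(** * Monotonicity along the sweeps *)

Lemma eq_core_l1 (R : realType) (N : nat) (D d : 'I_N -> nat)
    (X : tensor R D) (V V' : forall m, 'M[R]_(D m, d m)) :
  (forall m, V m = V' m) -> core_l1 X V = core_l1 X V'.
Proof.
move=> eqV; apply: eq_bigr => j _; congr `|_|; apply: eq_bigr => k _.
by congr (_ * _); apply: eq_bigr => m _; rewrite eqV.
Qed.

(* The bases during sweep [q], once the modes below [k] have been updated. *)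
Definition sweep_state (R : realType) (N : nat) (D d : 'I_N -> nat)
    (U : nat -> forall m, 'M[R]_(D m, d m)) (q k : nat) :
    forall m, 'M[R]_(D m, d m) :=
  fun m => if (m < k)%N then U q m else U q.-1 m.

Lemma l1norm_hooi_mx (R : realType) (N : nat) (D d : 'I_N -> nat)
    (X : tensor R D) (U : nat -> forall m, 'M[R]_(D m, d m)) (q : nat)
    (n : 'I_N) :
  l1norm ((U q n)^T *m hooi_mx X U q n) = core_l1 X (sweep_state U q n.+1).
Proof.
have -> : U q n = sweep_state U q n.+1 n by rewrite /sweep_state ltnSn.
apply: l1norm_unfold_ttms => m mn.
(* For [m] other than [n], [m < n.+1] and [m < n] are equivalent, so these are the bases used in
   [hooi_mx]. *)
by rewrite /sweep_state ltnS [in RHS]leq_eqVlt (inj_eq (@ord_inj N)) (negbTE mn).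
Qed.

(** [hooi_mx] is built from the modes other than [n], so the same matrix measures the objective
    before and after the update of mode [n]. *)
Lemma l1norm_hooi_mx_prev (R : realType) (N : nat) (D d : 'I_N -> nat)
    (X : tensor R D) (U : nat -> forall m, 'M[R]_(D m, d m)) (q : nat)
    (n : 'I_N) :
  l1norm ((U q.-1 n)^T *m hooi_mx X U q n) = core_l1 X (sweep_state U q n).
Proof.
have -> : U q.-1 n = sweep_state U q n n by rewrite /sweep_state ltnn.
exact: l1norm_unfold_ttms.
Qed.

Lemma l1_hooi_stiefel (R : realType) (N : nat) (D d : 'I_N -> nat)
    (X : tensor R D) (U : nat -> forall m, 'M[R]_(D m, d m)) (q : nat)
    (n : 'I_N) : l1_hooi X U -> stiefel (U q n).
Proof.
by case=> hU0 hU; case: q => [//|q]; apply: l1pca_ao_stiefel (hU q.+1 n isT).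
Qed.

Lemma core_l1_update_le (R : realType) (N : nat) (D d : 'I_N -> nat)
    (X : tensor R D) (U : nat -> forall m, 'M[R]_(D m, d m)) (q : nat)
    (n : 'I_N) :
  l1_hooi X U -> (0 < q)%N ->
  core_l1 X (sweep_state U q n) <= core_l1 X (sweep_state U q n.+1).
Proof.
move=> hU q_gt0; rewrite -l1norm_hooi_mx -l1norm_hooi_mx_prev.
by apply: l1pca_ao_l1norm_le; [apply: l1_hooi_stiefel hU | apply: hU.2].
Qed.

Lemma core_l1_sweep_le (R : realType) (N : nat) (D d : 'I_N -> nat)
    (X : tensor R D) (U : nat -> forall m, 'M[R]_(D m, d m)) (q k l : nat) :
  l1_hooi X U -> (0 < q)%N -> (k <= l <= N)%N ->
  core_l1 X (sweep_state U q k) <= core_l1 X (sweep_state U q l).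
Proof.
move=> hU q_gt0 /andP[]; elim: l => [|l IHl]; first by rewrite leqn0 => /eqP->.
rewrite leq_eqVlt => /predU1P[-> //|lt_kl] lt_lN.
apply: le_trans (IHl lt_kl (ltnW lt_lN)) _.
exact: (core_l1_update_le (Ordinal lt_lN) hU q_gt0).
Qed.

(** The path runs from state [k] to the end of sweep [q], then from the start of the next sweep to
    its state [k]. *)
Lemma core_l1_next_sweep_le (R : realType) (N : nat) (D d : 'I_N -> nat)
    (X : tensor R D) (U : nat -> forall m, 'M[R]_(D m, d m)) (q k : nat) :
  l1_hooi X U -> (0 < q)%N -> (k <= N)%N ->
  core_l1 X (sweep_state U q k) <= core_l1 X (sweep_state U q.+1 k).
Proof.
move=> hU q_gt0 le_kN.
apply: le_trans (core_l1_sweep_le hU (ltn0Sn q) (_ : 0 <= k <= N)%N) => //.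
(* A sweep starts from the bases with which the previous one ended. *)
have -> : core_l1 X (sweep_state U q.+1 0) = core_l1 X (sweep_state U q N).
  by apply: eq_core_l1 => m; rewrite /sweep_state ltn_ord.
by apply: core_l1_sweep_le; rewrite ?le_kN ?leqnn.
Qed.

Theorem proposition1 (R : realType) (N : nat) (D d : 'I_N -> nat)
    (hd : forall n : 'I_N, (d n <= D n)%N)
    (X : tensor R D) (U : nat -> forall n : 'I_N, 'M[R]_(D n, d n))
    (hU : l1_hooi X U)
    (n : 'I_N) (q q' : nat) (hq : (1 <= q)%N) (hqq' : (q < q')%N) :
  l1norm ((U q' n)^T *m hooi_mx X U q' n)
    >= l1norm ((U q n)^T *m hooi_mx X U q n).
Proof.
(* Both norms are the objective at state [n.+1] of their sweeps, so one sweep at a time suffices. *)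
rewrite !l1norm_hooi_mx; elim: q' hqq' => [//|q' IHq'].
rewrite ltnS leq_eqVlt => /predU1P[<-|lt_qq'].
  exact: core_l1_next_sweep_le.
apply: le_trans (IHq' lt_qq') _; apply: core_l1_next_sweep_le => //.
exact: leq_trans (ltnW lt_qq').
Qed.
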